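(* Let $A = \mathbb{R}_{\bot,\log_2}$ be the common meadow of real numbers expanded with the totalised binary logarithm. Then $A$ does not allow the entropy $H^V_\bot(P)$ of a probability mass function $P$ on a sample space $V$ of size $n=2$ to be defined by a term over $A$; that is, $A$ does not allow term expressions for entropy for sample spaces of size $2$.
   Context: The algebra $\mathbb{R}_{\bot,\log_2}$ has domain $\mathbb{R}\cup\{\bot\}$ with $\bot\notin\mathbb{R}$, constants $0,1,\bot$, and total operations $x+y$, $-x$, $x\cdot y$, $\frac{x}{y}$, $\log_2(x)$. On real arguments these are the usual operations, except that $\frac{x}{0}=\bot$ for all $x$, and $\log_2(x)=\bot$ for real $x\le 0$. The element $\bot$ is absorptive: each operation returns $\bot$ whenever one of its arguments is $\bot$. A probability mass function on a finite set $V$ is a function $P:V\to\mathbb{R}$ with $P(x)\ge 0$ for all $x\in V$ and $\sum_{x\in V}P(x)=1$. Left-sequential multiplication on $\mathbb{R}\cup\{\bot\}$: $x\ltimes y = 0$ if $x=0$ (also when $y=\bot$), and $x\ltimes y = x\cdot y$ if $x\neq 0$ (so $\bot\ltimes y=\bot$). Entropy is $H^V_\bot(P) = -\sum_{x\in V}P(x)\ltimes\log_2 P(x)$, i.e. the sum of $-P(x)\log_2 P(x)$ over those $x\in V$ with $P(x)>0$. Let $A$ be an algebra on $\mathbb{R}\cup\{\bot\}$ with signature $\Sigma$. $A$ allows term expressions for entropy for sample spaces of size $n$ if, for new constants $c_1,\dots,c_n$, there is a closed expression $\phi^n_H(\alpha)$ over $\Sigma\cup\{c_1,\dots,c_n\}$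 and a unary function variable $\alpha$, such that for every $V\subseteq\mathbb{R}$ with $|V|=n$, every interpretation of $c_1,\dots,c_n$ as an enumeration of $V$ without repetitions, and every probability mass function $P$ on $V$, $H^V_\bot(P)=[P/\alpha]\phi^n_H(\alpha)$ (the value in $A$ of the expression with $\alpha$ interpreted as $P$). Since $P$ is defined only on $V$, it is required that in all these evaluations $\alpha$ is applied only to arguments whose value lies in $V$. *)

(* Defs.v *)
From mathcomp Require Import all_boot all_order all_algebra finmap.
From mathcomp Require Import all_classical all_reals all_analysis.

Set Implicit Arguments.
Unset Strict Implicit.
Unset Printing Implicit Defensive.

Import Order.TTheory GRing.Theory Num.Theory.
Local Open Scope ring_scope.

(* The carrier R \cup {bot} is [option R], with [None] playing the role of
   the absorptive element bot. *)

Section TotalOperations.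
Variable R : realType.
Implicit Types x y : option R.

Definition madd x y : option R :=
  if (x, y) is (Some a, Some b) then Some (a + b) else None.

Definition mopp x : option R :=
  if x is Some a then Some (- a) else None.

Definition mmul x y : option R :=
  if (x, y) is (Some a, Some b) then Some (a * b) else None.

Definition mdiv x y : option R :=
  if (x, y) is (Some a, Some b) then
    if b == 0 then None else Some (a / b)
  else None.

Definition mlog2 x : option R :=
  if x is Some a then
    if 0 < a then Some (ln a / ln 2) else None
  else None.

(* Left-sequential multiplication: 0 on the left short-circuits even bot. *)
Definition lsmul x y : option R :=
  if x == Some 0 then Some 0 else mmul x y.

End TotalOperations.

Record signature := Signature {
  sig_op : Type;
  arity : sig_op -> nat }.

Record algebra (S : signature) (T : Type) := Algebra {
  interp : forall o : sig_op S, ('I_(arity o) -> T) -> T }.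

Inductive meadow_op :=
  | OpZero | OpOne | OpBot | OpAdd | OpOpp | OpMul | OpDiv | OpLog2.

Definition meadow_arity (o : meadow_op) : nat :=
  match o with
  | OpZero | OpOne | OpBot => 0
  | OpOpp | OpLog2 => 1
  | OpAdd | OpMul | OpDiv => 2
  end.

Definition log_meadow_sig : signature := Signature meadow_arity.

Definition log_meadow_interp (R : realType) (o : meadow_op) :
    ('I_(meadow_arity o) -> option R) -> option R :=
  match o return ('I_(meadow_arity o) -> option R) -> option R with
  | OpZero => fun=> Some 0
  | OpOne => fun=> Some 1
  | OpBot => fun=> None
  | OpAdd => fun a => madd (a ord0) (a ord_max)
  | OpOpp => fun a => mopp (a ord0)
  | OpMul => fun a => mmul (a ord0) (a ord_max)
  | OpDiv => fun a => mdiv (a ord0) (a ord_max)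
  | OpLog2 => fun a => mlog2 (a ord0)
  end.

Definition log_meadow (R : realType) : algebra log_meadow_sig (option R) :=
  @Algebra log_meadow_sig (option R) (@log_meadow_interp R).

(* Closed expressions over S extended with n fresh constants and one unary
   function variable alpha. *)
Inductive expr (S : signature) (n : nat) : Type :=
  | ECst of 'I_n
  | EAlpha of expr S n
  | EOp (o : sig_op S) of ('I_(arity o) -> expr S n).

Section Evaluation.
Variables (R : realType) (S : signature) (A : algebra S (option R)) (n : nat).
Variables (V : {fset R}) (c : 'I_n -> V) (P : V -> R).

(* An application of alpha outside V gets the junk value bot; [alpha_in]
   below rules such applications out. *)
Fixpoint eval (e : expr S n) : option R :=
  match e with
  | ECst i => Some (val (c i))
  | EAlpha e1 => obind (fun x : R => omap P (insub x)) (eval e1)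
  | EOp o args => @interp S (option R) A o (fun i => eval (args i))
  end.

(* Every application of alpha in e, at any depth, has its argument in V. *)
Fixpoint alpha_in (e : expr S n) : Prop :=
  match e with
  | ECst _ => True
  | EAlpha e1 => alpha_in e1 /\ exists v : V, eval e1 = Some (val v)
  | EOp o args => forall i, alpha_in (args i)
  end.

End Evaluation.

Definition is_pmf (R : realType) (V : {fset R}) (P : V -> R) : Prop :=
  (forall x, 0 <= P x) /\ \sum_(x : V) P x = 1.

Definition entropy (R : realType) (V : {fset R}) (P : V -> R) : option R :=
  mopp (\big[@madd R/Some 0]_(x : V)
          lsmul (Some (P x)) (mlog2 (Some (P x)))).

Definition allows_entropy_terms (R : realType) (S : signature)
    (A : algebra S (option R)) (n : nat) : Prop :=
  exists phi : expr S n,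
    forall (V : {fset R}) (c : 'I_n -> V) (P : V -> R),
      #|` V| = n -> bijective c -> is_pmf P ->
      alpha_in A c P phi /\ entropy P = eval A c P phi.

(* Main.v *)
(** Every operation other than [alpha] is strict in bot, so a term that
    evaluates to a real number never divides by 0 nor takes the logarithm of a
    nonpositive number.  Evaluate it on [V = {0, 1}] with [P 0 = p],
    [P 1 = 1 - p]: since its value at [p = 0] is a real number, the term is, as
    a function of [p], differentiable at [p = 0].  (An argument of [alpha] is
    continuous in [p] with values in the finite set [V], hence locally
    constant.)  The binary entropy, however, is at least [- p log2 p], which
    has an infinite right derivative at 0. *)
Require Import Defs.
From mathcomp Require Import all_boot all_order all_algebra finmap.
From mathcomp Require Import all_classical all_reals all_analysis.

Set Implicit Arguments.
Unset Strict Implicit.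
Unset Printing Implicit Defensive.

Import Order.TTheory GRing.Theory Num.Theory.
Import numFieldNormedType.Exports.
Local Open Scope classical_set_scope.
Local Open Scope ring_scope.

Section TermsAreDifferentiable.
Variable R : realType.
Implicit Types (f g : R -> R) (V : {fset R}).

(** The finite set [V] minus [f x] is closed, so continuity keeps [f y] outside it for [y] near
    [x]. *)
Lemma near_locally_constant V f (x : R) : {for x, continuous f} ->
  \forall y \near x, f y \in V -> f y = f x.
Proof.
move=> fc.
have /hausdorff_accessible/accessible_finite_set_closed cl := @Rhausdorff R.
have op : open (~` [set` (V `\ f x)%fset]).
  by rewrite openC; apply: cl; exact: finite_fset.
have : nbhs (f x) (~` [set` (V `\ f x)%fset]).
  by apply: open_nbhs_nbhs; split=> //=; rewrite !inE eqxx.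
move=> /fc fV; have {fV} : \forall y \near x, ~ (f y \in V `\ f x)%fset by [].
apply: filterS => y /negP.
by rewrite !inE negb_and negbK => /orP[/eqP //|/negPf ->].
Qed.

Lemma derivable_ln f (x : R) : 0 < f x -> derivable f x 1 ->
  derivable (fun y => ln (f y)) x 1.
Proof.
move=> fx0 df; apply/derivable1_diffP.
apply: differentiable_comp; first exact/derivable1_diffP.
by apply/derivable1_diffP; have [] := is_derive1_ln fx0.
Qed.

Variables (n : nat) (V : {fset R}) (c : 'I_n -> V) (P : R -> V -> R).
Hypothesis dP : forall v, derivable (P^~ v) 0 1.

Local Notation value p := (Defs.eval (log_meadow R) c (P p)).

(** The value is controlled only for [0 <= p], where [P p] can be a probability mass function.
    Asking for a two-sided differentiable [f] that agrees with it there lets the usual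
    differentiation rules carry the induction. *)
Lemma eval_derivable (e : expr log_meadow_sig n) :
  (\forall p \near (0 : R), 0 <= p -> value p e != None) ->
  exists2 f : R -> R, derivable f 0 1 &
    \forall p \near (0 : R), 0 <= p ->
      value p e = Some (f p).
Proof.
elim: e => [i|e IH|o args IH] def.
- by exists (fun=> val (c i)); [exact: derivable_cst|near=> p].
- have [|f df ef] := IH.
    by apply: filterS def => p /[apply] /=; case: Defs.eval.
  have fc : {for 0, continuous f}.
    exact/differentiable_continuous/derivable1_diffP.
  have f0V : f 0 \in V.
    move: (nbhs_singleton def (lexx _)) => /=.
    by rewrite (nbhs_singleton ef (lexx _)) /=; case: insubP.
  (* Near 0 the argument of [alpha] stays equal to [f 0], so only the dependence of [P p] on [p] at
     this fixed point remains. *)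
  exists (P^~ [` f0V]%fset); first exact: dP.
  apply: filterS3 def ef (near_locally_constant V fc) => p defp efp fpV p0.
  move: (defp p0); rewrite /= efp //=; case: insubP => //= v vV vE _.
  by congr (Some (P p _)); apply: val_inj; rewrite /= vE fpV.
(* Strictness in argument [i] passes definedness down to it, so the induction hypothesis applies. *)
have strict_arg (i : 'I_(arity o)) :
    (forall p, value p (args i) = None -> value p (EOp args) = None) ->
    exists2 f : R -> R, derivable f 0 1 &
    \forall p \near (0 : R), 0 <= p ->
      value p (args i) = Some (f p).
  move=> strict; apply: IH; apply: filterS def => p /[apply].
  by apply: contra_neq => /strict.
case: o args IH def strict_arg => args IH def strict_arg.
- by exists (fun=> 0); [exact: derivable_cst|near=> p].
- by exists (fun=> 1); [exact: derivable_cst|near=> p].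
- by move: (nbhs_singleton def (lexx _)).
- have [p /= ->|f df ef] := strict_arg ord0; first by [].
  have [p /= ->|g dg eg] := strict_arg ord_max;
    first by rewrite /madd; case: Defs.eval.
  exists (f + g); first exact: (derivableD df dg).
  by apply: filterS2 ef eg => p efp egp p0 /=; rewrite efp // egp.
- have [p /= ->|f df ef] := strict_arg ord0; first by [].
  exists (- f); first exact: (derivableN df).
  by apply: filterS ef => p efp p0 /=; rewrite efp.
- have [p /= ->|f df ef] := strict_arg ord0; first by [].
  have [p /= ->|g dg eg] := strict_arg ord_max;
    first by rewrite /mmul; case: Defs.eval.
  exists (f * g); first exact: (derivableM df dg).
  by apply: filterS2 ef eg => p efp egp p0 /=; rewrite efp // egp.
- have [p /= ->|f df ef] := strict_arg ord0; first by [].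
  have [p /= ->|g dg eg] := strict_arg ord_max;
    first by rewrite /mdiv; case: Defs.eval.
  (* Definedness at [p = 0] itself excludes a zero denominator there. *)
  have g0 : g 0 != 0.
    move: (nbhs_singleton def (lexx _)) => /=.
    rewrite (nbhs_singleton ef (lexx _)) (nbhs_singleton eg (lexx _)) /mdiv.
    by case: (g 0 == 0).
  exists (f * (fun p => (g p)^-1)).
    exact: (derivableM df (derivableV g0 dg)).
  apply: filterS3 def ef eg => p defp efp egp p0.
  move: (defp p0); rewrite /= efp // egp // /mdiv.
  by case: (g p == 0); rewrite ?eqxx.
- have [p /= ->|f df ef] := strict_arg ord0; first by [].
  have f0 : 0 < f 0.
    move: (nbhs_singleton def (lexx _)) => /=.
    by rewrite (nbhs_singleton ef (lexx _)) /=; case: (0 < f 0).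
  exists ((fun p => ln (f p)) * (fun=> (ln 2)^-1)).
    exact: (derivableM (derivable_ln f0 df) (derivable_cst _ _ _)).
  apply: filterS2 def ef => p defp efp p0.
  move: (defp p0); rewrite /= efp //=.
  by case: (0 < f p); rewrite ?eqxx.
Unshelve. all: by end_near.
Qed.

End TermsAreDifferentiable.

Section BinaryEntropy.
Variable R : realType.

(** The difference quotient at [h > 0] is at least [- ln h / ln 2], which is unbounded as [h] tends
    to 0. *)
Lemma not_derivable_entropy_bound (f : R -> R) : f 0 = 0 ->
  (\forall p \near (0 : R), 0 < p -> - (p * (ln p / ln 2)) <= f p) ->
  ~ derivable f 0 1.
Proof.
move=> f0 fge df.
have ln2 : 0 < ln 2 :> R by rewrite ln_gt0 // ltr1n.
pose M := 'D_1 f 0 + 1.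
have qM : \forall h \near (0 : R)^'+, h^-1 *: (f (h *: 1 + 0) - f 0) < M.
  by apply: cvgr_lt (cvg_dnbhs_at_right df) _ _; rewrite /M ltrDl.
have fge0 : \forall h \near (0 : R)^'+, - (h * (ln h / ln 2)) <= f h by [].
have : \forall h \near (0 : R)^'+, False.
  near=> h.
  have h0 : 0 < h by [].
  have : h^-1 *: (f (h *: 1 + 0) - f 0) < M by near: h.
  rewrite f0 subr0 addr0 /GRing.scale /= mulr1 mulrC ltr_pdivrMr //.
  have : - (h * (ln h / ln 2)) <= f h by exact: (near fge0 h).
  move=> /le_lt_trans /[apply].
  rewrite -mulrN mulrC ltr_pM2r // ltNge => /negP; apply.
  (* The contradiction arises once [h <= expR (- (M * ln 2))], that is, [h] is at most 2 to the
     power [-M]. *)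
  rewrite -mulNr ler_pdivlMr // lerNr -ler_expR lnK ?posrE //.
  by near: h; apply: nbhs_right_le; exact: expR_gt0.
by move=> /filter_ex [].
Unshelve. all: by end_near.
Qed.

Definition bit (i : 'I_2) : [fset 0; 1 : R]%fset :=
  if i == ord0 then [` fset21 0 1]%fset else [` fset22 0 1]%fset.

(** Affine in [p] on all of [R], hence differentiable at the endpoint 0 of the range where it is a
    probability mass function. *)
Definition bernoulli_pmf (p : R) (v : [fset 0; 1 : R]%fset) : R :=
  if val v == 0 then p else 1 - p.

Lemma bit_bij : bijective bit.
Proof.
exists (fun v : [fset 0; 1 : R]%fset =>
  if val v == 0 then ord0 else ord_max) => [i|v].
  by apply: val_inj; case: i => [[|[|//]] ?]; rewrite /bit /= ?eqxx ?oner_eq0.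
apply: val_inj; have := valP v; rewrite /= !inE.
by case/orP => /eqP ->; rewrite ?eqxx ?oner_eq0.
Qed.

Lemma sum_bernoulli (g : R -> R) (p : R) :
  \sum_v g (bernoulli_pmf p v) = g p + g (1 - p).
Proof.
rewrite (reindex bit) /=; last exact/onW_bij/bit_bij.
by rewrite !big_ord_recl big_ord0 addr0 /bernoulli_pmf /= eqxx oner_eq0.
Qed.

Lemma bernoulli_is_pmf (p : R) : 0 <= p <= 1 -> is_pmf (bernoulli_pmf p).
Proof.
move=> /andP[p0 p1]; split=> [v|].
  by rewrite /bernoulli_pmf; case: ifP; rewrite ?subr_ge0.
by rewrite (sum_bernoulli id) subrKC.
Qed.

(** Where [P v = 0], the short circuit of [lsmul] gives 0, and so does the real product, whatever
    the value of [ln 0]. *)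
Lemma entropyE (V : {fset R}) (P : V -> R) : (forall v, 0 <= P v) ->
  entropy P = Some (- \sum_v P v * (ln (P v) / ln 2)).
Proof.
move=> P0; rewrite /entropy.
rewrite (eq_bigr (fun v => Some (P v * (ln (P v) / ln 2)))) => [|v _].
  by rewrite -(@big_morph _ _ Some (Some 0) (@madd R) 0 +%R).
rewrite /lsmul /=; case: eqP => [[->]|/eqP Pv]; first by rewrite mul0r.
by rewrite lt_def P0 andbT ifT.
Qed.

End BinaryEntropy.

Theorem proposition4p1 (R : realType) :
  ~ allows_entropy_terms (log_meadow R) 2.
Proof.
move=> [phi phiP].
have ent p : 0 <= p <= 1 ->
    Defs.eval (log_meadow R) (@bit R) (bernoulli_pmf p) phi =
    Some (- (p * (ln p / ln 2) + (1 - p) * (ln (1 - p) / ln 2))).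
  move=> p01; have pmf := bernoulli_is_pmf p01.
  have [|_ <-] := phiP _ _ _ _ (@bit_bij R) pmf.
    by rewrite cardfs2 eq_sym oner_eq0.
  rewrite entropyE; last by case: pmf.
  by rewrite (sum_bernoulli (fun x => x * (ln x / ln 2))).
have le1 : \forall p \near (0 : R), 0 <= p -> p <= 1 by exact: lt_nbhsl_le.
have [v||f df ef] := @eval_derivable R 2 _ (@bit R) (@bernoulli_pmf R) _ phi.
- rewrite /bernoulli_pmf; case: (val v == 0); first exact: derivable_id.
  by apply: derivableB; [exact: derivable_cst|exact: derivable_id].
- by apply: filterS le1 => p le1 p0; rewrite ent // p0 le1.
- apply: (not_derivable_entropy_bound _ _ df).
    move: (nbhs_singleton ef (lexx _)); rewrite ent ?lexx ?ler01 // => -[<-].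
    by rewrite subr0 ln1 !mul0r mulr0 addr0 oppr0.
  apply: filterS2 le1 ef => p le1p efp p0; have p1 := le1p (ltW p0).
  move: (efp (ltW p0)); rewrite ent ?(ltW p0) // => -[<-].
  (* The contribution of [1 - p] to the entropy is nonnegative because [ln (1 - p) <= 0]; dropping
     it leaves the lower bound. *)
  rewrite opprD lerDl -mulrN mulr_ge0 ?subr_ge0 // -mulNr divr_ge0 //.
    by rewrite oppr_ge0 ln_le0 // gerBl ltW.
  by rewrite ln_ge0 // ler1n.
Qed.
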